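(* Let $G$ be a signed graph and let $\phi$ be an integer flow on $G$. Then there exist a positive orientation of $G$ with respect to $\phi$, a set $\mathcal{C}$ of signed circuits of $G$ each of which is consistently directed with respect to this orientation, and positive integers $n_C$ ($C\in\mathcal{C}$) such that, with $\phi$ expressed in terms of this orientation, $$\phi=\sum_{C\in\mathcal{C}} n_C\,\chi_C,$$ where $\chi_C\colon E(G)\to\{0,1/2,1\}$ is the characteristic flow of $C$. (The empty sum is the zero flow.)
   Context: Graphs are finite; loops and parallel edges are allowed. A circuit is a connected 2-regular subgraph (a loop is a circuit of length 1, two parallel edges form a circuit of length 2). A *signed graph* is a graph in which each edge is labelled with a sign, $+$ or $-$. Orientation: each edge is divided into two half-edges, one at each of its ends (both at the same vertex for a loop). An *orientation* (bidirection) of a signed graph assigns a direction to each half-edge, either towards or from its end-vertex, so that a positive edge has one half-edge directed from and the other half-edge directed to its end-vertex, while a negative edge has both half-edges directed towards, or both directed from, their respective end-vertices. Thus each edge has exactly two possible orientations, opposite to each other. Flows: an *integer flow* on a signed graph $G$ is an assignment of an orientation and an integer value to each edge such that at each vertex the sum of incoming values equals the sum of outgoing values (every half-edge at the vertex contributes the value of its edge, as incoming if it is directed to the vertex and as outgoing otherwise). Reversing the orientation of an edge $e$ and replacing $\phi(e)$ by $-\phi(e)$ is regarded as expressing the same flow in terms of a different orientation. A *positive orientation* of $G$ with respect to an integer flow $\phi$ is an orientation such that, when $\phi$ is expressed in terms of it, $\phi(e)\ge 0$ for each edge $e$. Flows expressed in terms of one fixed orientation are added edgewise. Signed circuits: a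 circuit is *balanced* if it contains an even number of negative edges, otherwise *unbalanced*. A *signed circuit* of a signed graph is a subgraph of one of the following types: (1) a balanced circuit; (2) the union of two disjoint unbalanced circuits with a path that meets the circuits only at its ends; (3) the union of two unbalanced circuits that meet at a single vertex. Signed circuits of types (2) and (3) are called *unbalanced bicircuits*; in type (3) the connecting path is regarded as trivial, consisting of the common vertex only. Consistency: let $G$ be equipped with an orientation. Two adjacent edges $e,f$ sharing a vertex $v$ are *consistently directed* at $v$ if exactly one of the two half-edges (of $e$ and of $f$) incident with $v$ is directed to $v$; for a circuit that is a loop, this applies to the two half-edges of the loop. A balanced circuit is *consistently directed* if all its pairs of consecutive edges are consistently directed. An unbalanced bicircuit is *consistently directed* if every pair of adjacent edges in it (at each shared vertex) is consistently directed except for the two edges (half-edges, in the case of a loop) of either circuit that share an end-vertex of the connecting path, and these two are not consistently directed. Characteristic flow: for a signed circuit $C$ of $G$ with a consistent orientation, $\chi_C\colon E(G)\to\{0,1/2,1\}$ is defined as follows. If $C$ is a balanced circuit, then $\chi_C(e)=1$ for each edge $e$ of $C$ and $\chi_C(e)=0$ otherwise. If $C$ is an unbalanced bicircuit, then $\chi_C(e)=1$ if $e$ belongs to the connecting path of $C$, $\chi_C(e)=1/2$ if $e$ belongs to one of the two circuits of $C$, and $\chi_C(e)=0$ otherwise. *)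

(* Defs.v *)
From HB Require Import structures.
From mathcomp Require Import all_boot all_order all_algebra.

Set Implicit Arguments.
Unset Strict Implicit.
Unset Printing Implicit Defensive.

Import Order.TTheory GRing.Theory Num.Theory.

(* The half-edges of an edge e are (e, false) and (e, true); hend maps a      *)
(* half-edge to its end-vertex. The choice of which half is which carries no  *)
(* meaning. A loop has hend (e, false) = hend (e, true).                      *)
Record signed_graph := SignedGraph {
  vertex : finType;
  edge : finType;
  hend : edge * bool -> vertex;
  negative : pred edge
}.

Definition half_edge (G : signed_graph) : finType := (edge G * bool)%type.

Definition other (G : signed_graph) (h : half_edge G) : half_edge G :=
  (h.1, ~~ h.2).

Section Orientations.
Variable G : signed_graph.

(* o h = true means that the half-edge h is directed towards its end-vertex.  *)
Definition is_orientation (o : half_edge G -> bool) : Prop :=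
  forall e : edge G, (o (e, false) == o (e, true)) = negative e.

Local Open Scope ring_scope.

Definition is_flow (o : half_edge G -> bool) (phi : edge G -> int) : Prop :=
  forall x : vertex G,
    \sum_(h : half_edge G | (hend h == x) && o h) phi h.1 =
    \sum_(h : half_edge G | (hend h == x) && ~~ o h) phi h.1.

(* The flow given by phi in terms of o, expressed in terms of o'.             *)
Definition express (o o' : half_edge G -> bool) (phi : edge G -> int)
    (e : edge G) : int :=
  if [forall b : bool, o' (e, b) == o (e, b)] then phi e else - phi e.

Definition positive_orientation (o : half_edge G -> bool) (phi : edge G -> int)
    (o' : half_edge G -> bool) : Prop :=
  is_orientation o' /\ forall e : edge G, 0 <= express o o' phi e.

End Orientations.

(* A vertex set and an edge set; see is_subgraph for the incidence condition. *)
Definition subgraph (G : signed_graph) : finType :=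
  ({set vertex G} * {set edge G})%type.

Section SignedCircuits.
Variable G : signed_graph.
Implicit Types (C P : subgraph G) (u v x y : vertex G) (h k : half_edge G).

Definition is_subgraph C : bool :=
  [forall h : half_edge G, (h.1 \in C.2) ==> (hend h \in C.1)].

Definition sub_union C P : subgraph G := (C.1 :|: P.1, C.2 :|: P.2).

(* Degrees count half-edges, so that a loop contributes 2.                    *)
Definition degree C x : nat :=
  #|[set h : half_edge G | (h.1 \in C.2) && (hend h == x)]|.

Definition adjacent C x y : bool :=
  [exists h : half_edge G,
     [&& h.1 \in C.2, hend h == x & hend (other h) == y]].

Definition connected C : bool :=
  (C.1 != set0) &&
  [forall x in C.1, forall y in C.1, connect (adjacent C) x y].

Definition is_circuit C : bool :=
  [&& is_subgraph C, connected C & [forall x in C.1, degree C x == 2]].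

Definition balanced_circuit C : bool :=
  is_circuit C && ~~ odd #|[set e in C.2 | negative e]|.

Definition unbalanced_circuit C : bool :=
  is_circuit C && odd #|[set e in C.2 | negative e]|.

(* The half-edge h in a walk stands for its edge traversed from other h to h. *)
Fixpoint walk u (p : seq (half_edge G)) : bool :=
  if p is h :: p' then (hend (other h) == u) && walk (hend h) p' else true.

Definition walk_vertices u (p : seq (half_edge G)) : seq (vertex G) :=
  u :: [seq hend h | h <- p].

(* No vertex repeats, hence no edge repeats and the length of p is #|P.2|.    *)
Definition is_path P u v : bool :=
  [exists p : #|P.2|.-tuple (half_edge G),
     [&& walk u p, last u (walk_vertices u p) == v, uniq (walk_vertices u p),
         P.1 == [set x in walk_vertices u p] &
         P.2 == [set e in [seq h.1 | h : half_edge G <- p]]]].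

Definition long_bicircuit C C1 P C2 u v : bool :=
  [&& unbalanced_circuit C1, unbalanced_circuit C2, [disjoint C1.1 & C2.1],
      is_path P u v, P.1 :&: C1.1 == [set u], P.1 :&: C2.1 == [set v] &
      C == sub_union (sub_union C1 P) C2].

(* Edge-disjointness is not redundant: without it, C1 and C2 could be the     *)
(* same negative loop.                                                        *)
Definition tight_bicircuit C C1 P C2 u v : bool :=
  [&& unbalanced_circuit C1, unbalanced_circuit C2,
      C1.1 :&: C2.1 == [set u], [disjoint C1.2 & C2.2], v == u,
      P == ([set u], set0) & C == sub_union C1 C2].

(* The parts of C are unique, up to exchanging (C1, u) and (C2, v).           *)
Definition bicircuit_parts C C1 P C2 u v : bool :=
  long_bicircuit C C1 P C2 u v || tight_bicircuit C C1 P C2 u v.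

Definition unbalanced_bicircuit C : bool :=
  [exists C1, exists P, exists C2, exists u, exists v,
     bicircuit_parts C C1 P C2 u v].

Definition signed_circuit C : bool :=
  balanced_circuit C || unbalanced_bicircuit C.

(* For half-edges h and k at the same vertex: exactly one is directed to it.  *)
Definition consistent_pair (o : half_edge G -> bool) h k : bool := o h != o k.

Definition consistent_balanced (o : half_edge G -> bool) C : bool :=
  [forall h : half_edge G, forall k : half_edge G,
     [&& h.1 \in C.2, k.1 \in C.2, h != k & hend h == hend k]
       ==> consistent_pair o h k].

Definition exceptional_pair C1 C2 u v h k : bool :=
  [&& h.1 \in C1.2, k.1 \in C1.2 & hend h == u] ||
  [&& h.1 \in C2.2, k.1 \in C2.2 & hend h == v].

Definition consistent_bicircuit (o : half_edge G -> bool) C : bool :=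
  [exists C1, exists P, exists C2, exists u, exists v,
     bicircuit_parts C C1 P C2 u v &&
     [forall h : half_edge G, forall k : half_edge G,
        [&& h.1 \in C.2, k.1 \in C.2, h != k & hend h == hend k]
          ==> (consistent_pair o h k == ~~ exceptional_pair C1 C2 u v h k)]].

Definition consistently_directed (o : half_edge G -> bool) C : bool :=
  if balanced_circuit C then consistent_balanced o C
  else consistent_bicircuit o C.

Definition on_connecting_path C (e : edge G) : bool :=
  [exists C1, exists P, exists C2, exists u, exists v,
     bicircuit_parts C C1 P C2 u v && (e \in P.2)].

Definition on_bicircuit_circuit C (e : edge G) : bool :=
  [exists C1, exists P, exists C2, exists u, exists v,
     bicircuit_parts C C1 P C2 u v && (e \in C1.2 :|: C2.2)].

Local Open Scope ring_scope.

(* Only meaningful when C is a signed circuit.                                *)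
Definition chi C (e : edge G) : rat :=
  if balanced_circuit C then (if e \in C.2 then 1 else 0)
  else if on_connecting_path C e then 1
  else if on_bicircuit_circuit C e then 1 / 2
  else 0.

End SignedCircuits.

(* Main.v *)
Require Import Defs.
From mathcomp Require Import all_boot all_order all_algebra.
From mathcomp Require Import ring lra.
From Stdlib Require Import Classical.

(** Give every vertex [x] two states: a walk is in state [(x, true)] when it has
    just arrived at [x] along a half-edge directed towards [x], and in state
    [(x, false)] when it arrived along one directed from [x]. Traversing an
    edge consistently with the orientation turns each half-edge [h] into an arc
    from [src h] to [dst h], so that consistent walks are the directed walks of
    a double cover of the graph ([cwalk]). The cover has the symmetry [flip],
    which exchanges the two states of each vertex and reverses the arcs, hence
    reverses walks ([mirror]). A closed walk that repeats no vertex of the graph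
    is a consistently directed balanced circuit if it returns to the state it
    started from, and an unbalanced circuit that is inconsistent exactly at its
    base vertex if it returns to the flipped state ([circuit_walk]).

    Reorienting the edges of negative value makes the flow [phi] nonnegative,
    and one argues by induction on the sum of its values. If the support
    contains a balanced [circuit_walk], its characteristic flow is subtracted.
    Otherwise, pairing incoming with outgoing units of flow yields a closed
    consistent walk that uses each edge at most as often as [phi] allows
    ([closed_walk_in_flow]); the number of passages through each edge is again
    a flow, and it remains to write it as a sum of characteristic flows.

    Such a closed walk repeats a vertex, so some segment of it is an unbalanced
    circuit [L], and cyclically the walk is [L] followed by a walk [R]. It is
    counted as one half of [L], plus [R], plus one half of [L]. More generally,
    let [R] lead from an unbalanced circuit [L] to an unbalanced circuit [M]
    ([decomposes_walk]). Follow [R] up to its first repeated vertex: this is a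
    path [P] followed by a new unbalanced circuit [L']. Since [L'] is one half
    plus one half of itself, L/2 + R + M/2 splits into L/2 + P + L'/2, which is
    the characteristic flow of a bicircuit, and L'/2 + R' + M/2 for a shorter
    walk [R']. Each intermediate circuit is thus shared by two successive
    bicircuits, and this is why integral coefficients suffice although the
    characteristic flows take the value 1/2.

    Two points need care. The pieces [L], [P], [L'] must meet only where they
    should: by [unbalanced_circuit_avoided], a walk that leaves the base of an
    unbalanced circuit and meets it again would close a balanced circuit, either
    along the rest of that circuit or along its mirror image. Moreover the
    characteristic flow of a bicircuit is determined by its edge set: the edges
    of a connecting path are bridges, so they lie on no circuit, whatever the
    chosen parts are ([connecting_path_off_circuits]). *)

Set Implicit Arguments.
Unset Strict Implicit.
Unset Printing Implicit Defensive.

Import Order.TTheory GRing.Theory Num.Theory.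

(** * Sequences *)

Lemma uniq_map_inj_in (T1 T2 : eqType) (f : T1 -> T2) (s : seq T1) :
  uniq [seq f x | x <- s] -> {in s &, injective f}.
Proof.
elim: s => [|z s IHs] //= /andP[zNs us] x y.
rewrite !inE => /predU1P[->|xs] /predU1P[->|ys] // fE.
- by rewrite fE map_f in zNs.
- by rewrite -fE map_f in zNs.
- exact: IHs.
Qed.

Lemma first_repeat (T : Type) (U : eqType) (f : T -> U) (x : U) (s : seq T) :
  ~~ uniq (x :: map f s) ->
  exists s1 y s2, [/\ s = s1 ++ y :: s2, uniq (x :: map f s1)
                    & f y \in x :: map f s1].
Proof.
elim/last_ind: s => [//|s y IHs] nu.
have [us|/IHs[s1 [z [s2 [-> u1 z1]]]]] := boolP (uniq (x :: map f s)).
  exists s, y, [::]; split; rewrite ?cats1 //.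
  by move: nu; rewrite map_rcons -rcons_cons rcons_uniq us andbT negbK.
by exists s1, z, (rcons s2 y); rewrite rcons_cat.
Qed.

Lemma split_at_value (T : Type) (U : eqType) (f : T -> U) (x y : U) (s : seq T) :
  y \in x :: map f s -> exists s1 s2, s = s1 ++ s2 /\ last x (map f s1) = y.
Proof.
elim: s x => [|z s IHs] x /=.
  by rewrite inE => /eqP->; exists [::], [::].
case/predU1P=> [->|/IHs[s1 [s2 [-> <-]]]]; first by exists [::], (z :: s).
by exists (z :: s1), s2.
Qed.

(** * Consistent walks in the double cover *)

Section ConsistentWalks.
Context {G : signed_graph}.
Variable o : half_edge G -> bool.
Implicit Types (h k : half_edge G) (p q : seq (half_edge G)).
Implicit Types (s t : vertex G * bool) (x y z : vertex G) (e : edge G).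

(** A state [(x, c)] must be left through a half-edge [k] at [x] with
    [o k = ~~ c]; hence the negation in [src], where the half-edge at the
    starting vertex is [other h]. *)
Definition dst h : vertex G * bool := (hend h, o h).
Definition src h : vertex G * bool := (hend (other h), ~~ o (other h)).
Definition flip s : vertex G * bool := (s.1, ~~ s.2).

Fixpoint cwalk s p : bool :=
  if p is h :: p' then (src h == s) && cwalk (dst h) p' else true.

Definition target s p := last s [seq dst h | h <- p].
Definition verts p := [seq hend h | h <- p].
Definition edges p := [seq h.1 | h <- p].
Definition mirror p := rev [seq other h | h <- p].

(** A circuit traversed from the state [s]: [b] is the parity of its number of
    negative edges. For [b = false] the walk is consistent at every vertex
    including its base [s.1]; for [b = true] it returns to [flip s], and the base
    is the only vertex where it is inconsistent. *)
Definition circuit_walk s b p :=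
  [&& p != [::], cwalk s p, target s p == (s.1, s.2 (+) b) & uniq (verts p)].

Lemma otherK : involutive (@other G).
Proof. by case=> e b; rewrite /other /= negbK. Qed.

Lemma other_neq h : other h != h.
Proof. by case: h => e b; rewrite /other xpair_eqE eqxx /=; case: b. Qed.

Lemma same_edge h k : h.1 = k.1 -> h = k \/ h = other k.
Proof.
case: h k => [e b] [e' b'] /= ->; rewrite /other /=.
by case: b b' => [] []; [left|right|right|left].
Qed.

Lemma src_other h : src (other h) = flip (dst h).
Proof. by rewrite /src otherK. Qed.

Lemma dst_other h : dst (other h) = flip (src h).
Proof. by rewrite /flip /= negbK. Qed.

Lemma cwalk_cat s p q : cwalk s (p ++ q) = cwalk s p && cwalk (target s p) q.
Proof. by elim: p s => //= h p IHp s; rewrite IHp andbA. Qed.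

Lemma cwalk_rcons s p h : cwalk s (rcons p h) = cwalk s p && (src h == target s p).
Proof. by rewrite -cats1 cwalk_cat /= andbT. Qed.

Lemma target_cat s p q : target s (p ++ q) = target (target s p) q.
Proof. by rewrite /target map_cat last_cat. Qed.

Lemma target_rcons s p h : target s (rcons p h) = dst h.
Proof. by rewrite /target map_rcons last_rcons. Qed.

Lemma target_vertex s p : (target s p).1 = last s.1 (verts p).
Proof. by rewrite /target -(last_map fst) -map_comp. Qed.

Lemma verts_cat p q : verts (p ++ q) = verts p ++ verts q.
Proof. exact: map_cat. Qed.

Lemma verts_rcons p h : verts (rcons p h) = rcons (verts p) (hend h).
Proof. exact: map_rcons. Qed.

Lemma edges_cat p q : edges (p ++ q) = edges p ++ edges q.
Proof. exact: map_cat. Qed.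

Lemma mem_mirror p h : (h \in mirror p) = (other h \in p).
Proof. by rewrite mem_rev -{1}[h]otherK (mem_map (inv_inj otherK)). Qed.

Lemma mirrorK : involutive mirror.
Proof.
by move=> p; rewrite /mirror map_rev revK -map_comp map_id_in // => h _; apply: otherK.
Qed.

Lemma edges_mirror p : edges (mirror p) = rev (edges p).
Proof. by rewrite /edges /mirror map_rev -map_comp. Qed.

(** A half-edge whose edge lies on [p] is either arrived along, by [p], or left
    along, in which case the mirrored walk arrives along it. Facts about
    departures follow in this way from facts about arrivals. *)
Lemma mem_edges p h : (h.1 \in edges p) = (h \in p) || (h \in mirror p).
Proof.
rewrite mem_mirror; apply/mapP/orP => [[k kp /same_edge[->|->]]|[hp|hp]].
- by left.
- by right; rewrite otherK.
- by exists h.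
- by exists (other h).
Qed.

Lemma cwalk_mirror s p : cwalk s p ->
  cwalk (flip (target s p)) (mirror p)
  /\ target (flip (target s p)) (mirror p) = flip s.
Proof.
elim: p s => [//|h p IHp] s /= /andP[/eqP <- /IHp[wp tp]].
rewrite /mirror /= rev_cons -/(mirror p) cwalk_rcons target_rcons.
by rewrite wp tp src_other eqxx dst_other.
Qed.

Lemma verts_mirror s p : cwalk s p -> verts (mirror p) = rev (belast s.1 (verts p)).
Proof.
rewrite /verts /mirror map_rev -map_comp => wp; congr rev.
by elim: p s wp => //= h p IHp s /andP[/eqP <- /IHp <-].
Qed.

Lemma verts_mirror_path s p : cwalk s p ->
  rev (s.1 :: verts p) = (target s p).1 :: verts (mirror p).
Proof.
by move=> wp; rewrite (verts_mirror wp) target_vertex lastI rev_rcons.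
Qed.

Lemma circuit_mirror s b p : circuit_walk s b p ->
  circuit_walk (s.1, ~~ (s.2 (+) b)) b (mirror p).
Proof.
case/and4P=> p0 wp /eqP tp up; have [wm] := cwalk_mirror wp.
rewrite tp /flip /= => tm; rewrite /circuit_walk -size_eq0 size_rev size_map size_eq0 p0.
move: wm; rewrite tp => ->; rewrite tm /=; apply/andP; split.
  by rewrite xpair_eqE eqxx /=; case: (s.2) b {tp tm} => [] [].
rewrite (verts_mirror wp) rev_uniq.
have := target_vertex s p; rewrite tp /=; elim/last_ind: p {tp tm wp} p0 up => // p h _ _.
rewrite verts_rcons last_rcons belast_rcons /= rcons_uniq => uh ->.
by [].
Qed.

(** Without its last arc, a circuit is a path: this gives access to induction,
    which the closed walk itself does not support. *)
Lemma circuit_rcons s b p : circuit_walk s b p -> exists q h,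
  [/\ p = rcons q h, cwalk s q, src h = target s q,
      dst h = (s.1, s.2 (+) b) & uniq (s.1 :: verts q)].
Proof.
case/and4P; elim/last_ind: p => // q h _ _.
rewrite cwalk_rcons target_rcons verts_rcons => /andP[wq /eqP tq] /eqP hh.
move: hh; rewrite rcons_uniq => -[hh oh] /andP[hq uq].
by exists q, h; split; rewrite ?tq //= /dst ?hh ?oh // -hh hq.
Qed.

Lemma mem_verts_src s p h : cwalk s p -> h \in p -> hend (other h) \in s.1 :: verts p.
Proof.
elim: p s => //= k p IHp s /andP[/eqP <- wp].
rewrite in_cons => /predU1P[->|/(IHp _ wp)]; first exact: mem_head.
by rewrite /= !in_cons => ->; rewrite orbT.
Qed.

Lemma mem_verts s p h : cwalk s p -> h.1 \in edges p -> hend h \in s.1 :: verts p.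
Proof.
move=> wp; rewrite mem_edges => /orP[hp|]; first by rewrite in_cons map_f ?orbT.
by rewrite mem_mirror => /(mem_verts_src wp); rewrite otherK.
Qed.

Lemma circuit_start s b p : circuit_walk s b p -> s.1 \in verts p.
Proof.
by case/circuit_rcons=> q [h [-> _ _ [<- _] _]]; rewrite verts_rcons mem_rcons mem_head.
Qed.

Lemma mem_verts_circuit s b p h : circuit_walk s b p ->
  h.1 \in edges p -> hend h \in verts p.
Proof.
move=> rp /mem_verts H; have /and4P[_ wp _ _] := rp.
by have := H _ wp; rewrite in_cons => /predU1P[->|//]; apply: circuit_start rp.
Qed.

Lemma predecessor s p h : cwalk s p -> h \in p ->
  src h = s \/ exists2 k, k \in p & dst k = src h.
Proof.
elim: p s => //= k p IHp s /andP[/eqP <- wp].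
rewrite in_cons => /predU1P[->|/(IHp _ wp)]; first by left.
by case=> [->|[j jp hj]]; right; [exists k|exists j]; rewrite // in_cons ?eqxx ?jp ?orbT.
Qed.

Lemma path_edges_uniq s p : cwalk s p -> uniq (s.1 :: verts p) -> uniq (edges p).
Proof.
elim: p s => //= h p IHp s /andP[/eqP <- wp] /=.
rewrite in_cons negb_or => /andP[/andP[_ sp] up]; rewrite (IHp _ wp up) andbT.
rewrite mem_edges mem_mirror negb_or; apply/andP; split.
  by move: up => /= /andP[+ _]; apply: contra => /(map_f _).
by apply: contra sp => /(map_f _).
Qed.

Lemma path_no_loop s p h : cwalk s p -> uniq (s.1 :: verts p) -> h \in p ->
  hend (other h) != hend h.
Proof.
elim: p s => //= k p IHp s /andP[/eqP <- wp] /andP[sp up].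
rewrite !in_cons => /predU1P[->|]; last exact: IHp wp up.
by apply: contraNneq sp; rewrite /= => ->; rewrite mem_head.
Qed.

(** Only a circuit of length 2 could use an edge twice without repeating a
    vertex, by traversing it back and forth; but an arc is never followed by its
    own reversal in a consistent walk. *)
Lemma circuit_edges_uniq s b p : circuit_walk s b p -> uniq (edges p).
Proof.
move=> rp; have /and4P[_ _ _ up] := rp.
have [q [h [pE wq th hh uq]]] := circuit_rcons rp.
rewrite pE /edges map_rcons rcons_uniq -/(edges q) (path_edges_uniq wq uq) andbT.
move: up; rewrite pE verts_rcons rcons_uniq => /andP[hq _].
rewrite mem_edges mem_mirror negb_or; apply/andP; split.
  by apply: contra hq => /(map_f _).
case/lastP: q wq th uq {hq pE} => // q k wq.
rewrite target_rcons => [[ht ot]].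
rewrite verts_rcons -rcons_cons rcons_uniq => /andP[uq _].
apply/negP; rewrite mem_rcons in_cons => /predU1P[hk|hq].
  by move: ot; rewrite hk; case: (o k).
by rewrite in_cons -ht map_f ?orbT in uq.
Qed.

Lemma pass_through s p h k : cwalk s p -> uniq (verts p) ->
  h \in p -> k \in mirror p -> hend h = hend k -> hend h != s.1 -> o h != o k.
Proof.
move=> wp up hp; rewrite mem_mirror => /(predecessor wp) + hk hs.
rewrite /src otherK => -[sE|[j jp [hj oj]]].
  by rewrite hk -sE eqxx in hs.
have <- : j = h by apply: (uniq_map_inj_in up); rewrite // hk.
by rewrite oj; case: (o k).
Qed.

Lemma pass_through_edges s p h k :
  cwalk s p -> uniq (verts p) -> uniq (verts (mirror p)) ->
  h.1 \in edges p -> k.1 \in edges p -> h != k -> hend h = hend k ->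
  hend h != s.1 -> o h != o k.
Proof.
move=> wp up um; rewrite !mem_edges => /orP[hp|hp] /orP[kp|kp] /eqP hk e n.
- by case: hk; apply: (uniq_map_inj_in up).
- exact: (pass_through wp up hp kp e n).
- by rewrite eq_sym; apply: (pass_through wp up kp hp (esym e)); rewrite -e.
- by case: hk; apply: (uniq_map_inj_in um).
Qed.

(** * Directions of the half-edges of circuits and paths *)

Lemma circuit_pass s b p h k : circuit_walk s b p ->
  h.1 \in edges p -> k.1 \in edges p -> h != k -> hend h = hend k ->
  hend h != s.1 -> o h != o k.
Proof.
move=> rp; have /and4P[_ wp _ up] := rp.
have /and4P[_ _ _ um] := circuit_mirror rp; exact: pass_through_edges.
Qed.

Lemma circuit_arrival s b p h : circuit_walk s b p ->
  h \in p -> hend h = s.1 -> o h = s.2 (+) b.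
Proof.
move=> rp hp hs; have /and4P[_ _ _ up] := rp.
have [q [k [pE _ _ [hk ok] _]]] := circuit_rcons rp.
suff -> : h = k by [].
by apply: (uniq_map_inj_in up); rewrite ?hs // pE mem_rcons mem_head.
Qed.

Lemma circuit_departure s b p h : circuit_walk s b p ->
  h \in mirror p -> hend h = s.1 -> o h = ~~ s.2.
Proof.
move/circuit_mirror=> rm hp hs; rewrite (circuit_arrival rm hp hs) /=.
by case: s.2 b {rm} => [] [].
Qed.

(** Arriving in state [flip s] and departing from state [s] involve half-edges
    of the same direction. *)
Lemma circuit_base s p h : circuit_walk s true p ->
  h.1 \in edges p -> hend h = s.1 -> o h = ~~ s.2.
Proof.
move=> rp; rewrite mem_edges => /orP[hp|hp]; last exact: circuit_departure rp hp.
by move/(circuit_arrival rp hp); rewrite addbT.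
Qed.

Lemma path_uniq_mirror s p : cwalk s p -> uniq (s.1 :: verts p) ->
  uniq ((target s p).1 :: verts (mirror p)).
Proof. by move=> wp; rewrite -(verts_mirror_path wp) rev_uniq. Qed.

Lemma path_start s p h : cwalk s p -> uniq (s.1 :: verts p) ->
  h.1 \in edges p -> hend h = s.1 -> (h \in mirror p) /\ o h = ~~ s.2.
Proof.
move=> wp /= /andP[sp up]; rewrite mem_edges => /orP[hp|hp] hs.
  by rewrite -hs map_f in sp.
split=> //; move: hp; rewrite mem_mirror => /(predecessor wp).
case=> [<-|[k kp [hk _]]]; first by rewrite /src otherK /= negbK.
by rewrite -hs -[h]otherK -hk map_f in sp.
Qed.

Lemma path_end s p h : cwalk s p -> uniq (s.1 :: verts p) ->
  h.1 \in edges p -> hend h = (target s p).1 -> (h \in p) /\ o h = (target s p).2.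
Proof.
move=> wp up hp hs; have [wm _] := cwalk_mirror wp.
have hm : h.1 \in edges (mirror p) by rewrite edges_mirror mem_rev.
have [] := path_start wm (path_uniq_mirror wp up) hm hs.
by rewrite mirrorK /= negbK.
Qed.

Lemma path_pass s p h k : cwalk s p -> uniq (s.1 :: verts p) ->
  h.1 \in edges p -> k.1 \in edges p -> h != k -> hend h = hend k ->
  [/\ hend h != s.1, hend h != (target s p).1 & o h != o k].
Proof.
move=> wp up hp kp hk e.
have [/andP[_ u1] /andP[_ u2]] := (up, path_uniq_mirror wp up).
have hs : hend h != s.1.
  apply: contraNneq hk => hs; apply/eqP.
  have [hm _] := path_start wp up hp hs.
  have [km _] := path_start wp up kp (etrans (esym e) hs).
  exact: (uniq_map_inj_in u2).
have ht : hend h != (target s p).1.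
  apply: contraNneq hk => ht; apply/eqP.
  have [hm _] := path_end wp up hp ht.
  have [km _] := path_end wp up kp (etrans (esym e) ht).
  exact: (uniq_map_inj_in u1).
split=> //; exact: (pass_through_edges wp u1 u2 hp kp).
Qed.

(** * The subgraph traced by a walk *)

Definition span s p : subgraph G := ([set x in s.1 :: verts p], [set e in edges p]).

Lemma span_vertex s p x : (x \in (span s p).1) = (x \in s.1 :: verts p).
Proof. by rewrite inE. Qed.

Lemma span_edge s p e : (e \in (span s p).2) = (e \in edges p).
Proof. by rewrite inE. Qed.

Lemma circuit_vertex s b p x : circuit_walk s b p -> (x \in (span s p).1) = (x \in verts p).
Proof.
move=> rp; rewrite span_vertex in_cons.
by case: eqP => // ->; rewrite (circuit_start rp).
Qed.

Lemma span_is_subgraph s p : cwalk s p -> is_subgraph (span s p).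
Proof.
move=> wp; apply/forallP=> h; apply/implyP.
by rewrite span_edge span_vertex; apply: mem_verts.
Qed.

Lemma adjacent_sym (C : subgraph G) : symmetric (adjacent C).
Proof.
suff H x y : adjacent C x y -> adjacent C y x by move=> x y; apply/idP/idP => /H.
case/existsP=> h /and3P[hC hx hy]; apply/existsP; exists (other h).
by rewrite otherK hC hx hy.
Qed.

Lemma walk_connect (C : subgraph G) s p x : cwalk s p -> {subset edges p <= C.2} ->
  x \in s.1 :: verts p -> connect (adjacent C) s.1 x.
Proof.
elim: p s => [|h p IHp] s /=; first by move=> _ _; rewrite inE => /eqP->.
case/andP=> /eqP <- wp sC; rewrite in_cons => /predU1P[->//|xp].
apply: connect_trans (IHp _ wp _ xp); last first.
  by move=> e ep; apply: sC; rewrite in_cons ep orbT.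
apply: connect1; apply/existsP; exists (other h).
by rewrite otherK /= !eqxx !andbT; apply: sC; rewrite mem_head.
Qed.

Lemma span_connected s p : cwalk s p -> connected (span s p).
Proof.
move=> wp; have sC : {subset edges p <= (span s p).2} by move=> e; rewrite span_edge.
apply/andP; split; first by apply/set0Pn; exists s.1; rewrite span_vertex mem_head.
apply/forall_inP=> x; rewrite span_vertex => xp.
apply/forall_inP=> y; rewrite span_vertex => yp.
apply: connect_trans (walk_connect wp sC yp).
rewrite (sym_connect_sym (adjacent_sym (span s p))).
exact: walk_connect xp.
Qed.

Lemma circuit_degree s b p x : circuit_walk s b p ->
  x \in (span s p).1 -> degree (span s p) x = 2.
Proof.
move=> rp; rewrite (circuit_vertex _ rp) => xp.
have rm := circuit_mirror rp; have /and4P[_ _ _ um] := rm; have /and4P[_ _ _ up] := rp.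
have /mapP[a ap xa] := xp.
have am : a.1 \in edges (mirror p) by rewrite edges_mirror mem_rev map_f.
have /mapP[k km ak] := mem_verts_circuit rm am.
rewrite /degree.
suff -> : [set h : half_edge G | (h.1 \in (span s p).2) && (hend h == x)] = [set a; k].
  rewrite cards2; suff -> : a != k by [].
  apply/eqP=> ek; move: km; rewrite -ek mem_mirror => am'.
  have := other_neq a; have := circuit_edges_uniq rp.
  by move/uniq_map_inj_in=> /(_ _ _ am' ap erefl) ->; rewrite eqxx.
apply/setP=> h; rewrite !inE mem_edges xa.
apply/andP/orP=> [[/orP[hp|hm] /eqP e]|[/eqP->|/eqP->]].
- by left; apply/eqP; apply: (uniq_map_inj_in up).
- by right; apply/eqP; apply: (uniq_map_inj_in um) => //; rewrite e.
- by rewrite ap eqxx.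
- by rewrite km orbT ak eqxx.
Qed.

Lemma span_circuit s b p : circuit_walk s b p -> is_circuit (span s p).
Proof.
move=> rp; have /and4P[_ wp _ _] := rp.
apply/and3P; split; [exact: span_is_subgraph | exact: span_connected |].
by apply/forall_inP=> x /(circuit_degree rp) ->.
Qed.

Hypothesis ho : is_orientation o.

(** An arc changes the sign of the state exactly when its edge is negative. *)
Lemma walk_sign s p : cwalk s p ->
  (target s p).2 = s.2 (+) odd (count (@negative G) (edges p)).
Proof.
elim: p s => [|h p IHp] s /=; first by rewrite addbF.
case/andP=> /eqP <- /IHp; rewrite /target /= => ->.
rewrite oddD oddb addbA; congr (_ (+) _); rewrite -ho.
by case: h => e [] /=; rewrite /other /=; case: (o _); case: (o _).
Qed.

Lemma circuit_parity s b p : circuit_walk s b p ->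
  odd #|[set e in (span s p).2 | negative e]| = b.
Proof.
move=> rp; have /and4P[_ wp /eqP tp _] := rp.
have := walk_sign wp; rewrite tp => /addbI ->; congr odd.
rewrite -size_filter -(card_uniqP (filter_uniq _ (circuit_edges_uniq rp))).
by apply: eq_card => e; rewrite !inE mem_filter andbC.
Qed.

Lemma circuit_balanced s p : circuit_walk s false p -> balanced_circuit (span s p).
Proof. by move=> rp; rewrite /balanced_circuit (span_circuit rp) (circuit_parity rp). Qed.

Lemma circuit_unbalanced s p : circuit_walk s true p -> unbalanced_circuit (span s p).
Proof. by move=> rp; rewrite /unbalanced_circuit (span_circuit rp) (circuit_parity rp). Qed.

Lemma circuit_consistent s p : circuit_walk s false p -> consistently_directed o (span s p).
Proof.
move=> rp; rewrite /consistently_directed circuit_balanced //.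
apply/forallP=> h; apply/forallP=> k; apply/implyP; rewrite !span_edge.
case/and4P=> hp kp hk /eqP e; have [hs|] := eqVneq (hend h) s.1;
  last exact: (circuit_pass rp hp kp hk e).
have ks : hend k = s.1 by rewrite -e.
have /and4P[_ _ _ up] := rp; have /and4P[_ _ _ um] := circuit_mirror rp.
rewrite /consistent_pair; move: hp kp; rewrite !mem_edges => /orP[hp|hp] /orP[kp|kp].
- by rewrite (uniq_map_inj_in up hp kp e) eqxx in hk.
- by rewrite (circuit_arrival rp hp hs) (circuit_departure rp kp ks) addbF; case: s.2.
- by rewrite (circuit_arrival rp kp ks) (circuit_departure rp hp hs) addbF; case: s.2.
- by rewrite (uniq_map_inj_in um hp kp e) eqxx in hk.
Qed.

Definition multiplicity p e : nat := count_mem e (edges p).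
Definition weight p e : rat := (multiplicity p e)%:R%R.

Lemma weight_uniq p e : uniq (edges p) -> weight p e = (e \in edges p)%:R%R.
Proof. by move=> up; rewrite /weight /multiplicity count_uniq_mem. Qed.

Lemma chi_balanced s p e : circuit_walk s false p -> chi (span s p) e = weight p e.
Proof.
move=> rp; rewrite /chi circuit_balanced // span_edge.
rewrite weight_uniq ?(circuit_edges_uniq rp) //.
by case: (e \in _).
Qed.

(** * Connecting paths consist of bridges *)

Lemma walk_cat u p q : walk u (p ++ q) = walk u p && walk (last u (verts p)) q.
Proof. by elim: p u => //= h p IHp u; rewrite IHp andbA. Qed.

Lemma walk_ends u p h : walk u p -> h \in p ->
  (hend h \in u :: verts p) && (hend (other h) \in u :: verts p).
Proof.
move=> wp hp; rewrite in_cons map_f // orbT /=.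
elim: p u wp hp => //= k p IHp u /andP[/eqP <- wp].
rewrite in_cons => /predU1P[->|/(IHp _ wp)]; first exact: mem_head.
by rewrite !in_cons => ->; rewrite orbT.
Qed.

Lemma cwalk_walk s p : cwalk s p -> walk s.1 p.
Proof. by elim: p s => //= h p IHp s /andP[/eqP <- /IHp ->]; rewrite /= eqxx. Qed.

Lemma walk_avoids_cut (W : {set vertex G}) s p : cwalk s p ->
  (forall h, h \in p -> (hend h \in W) = (hend (other h) \in W)) ->
  ((target s p).1 \in W) = (s.1 \in W).
Proof.
elim: p s => // h p IHp s /andP[/eqP <- wp] noX.
have -> : target (src h) (h :: p) = target (dst h) p by [].
rewrite IHp; [exact: (noX h (mem_head _ _)) | exact: wp |].
by move=> k kp; apply: noX; rewrite in_cons kp orbT.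
Qed.

(** A closed walk crosses a cut an even number of times, so it cannot cross it
    along a single edge that it uses once. *)
Lemma circuit_crosses_twice (W : {set vertex G}) s b p h :
  circuit_walk s b p -> h.1 \in edges p ->
  hend h \notin W -> hend (other h) \in W ->
  exists k, [/\ k.1 \in edges p, k.1 != h.1, hend k \in W & hend (other k) \notin W].
Proof.
move=> rp hp hW oW; have up := circuit_edges_uniq rp.
have /and4P[_ wp /eqP tp _] := rp.
pose crosses k := (k.1 != h.1) && ((hend k \in W) != (hend (other k) \in W)).
have [/hasP[k kp /andP[kh kW]]|] := boolP (has crosses p).
  have ke : k.1 \in edges p by apply/mapP; exists k.
  have [kin|kout] := boolP (hend k \in W).
    by exists k; rewrite ke kh kin; split=> //; move: kW; rewrite kin; case: (_ \in _).
  exists (other k); rewrite otherK; split=> //.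
  by move: kW; rewrite (negbTE kout); case: (_ \in _).
move/hasPn=> noX; case/mapP: hp => a ap ha.
have {ap}[l1 [l2 pE]] : exists l1 l2, p = l1 ++ a :: l2.
  by case: (path.splitPr ap) => l1 l2; exists l1, l2.
have na k : k \in l1 ++ l2 -> (hend k \in W) = (hend (other k) \in W).
  move=> kl; have kp : k \in p.
    by move: kl; rewrite pE !mem_cat in_cons => /orP[->|->]; rewrite ?orbT.
  have := noX k kp; rewrite negb_and !negbK => /orP[/eqP|/eqP//].
  have pa := permEl (perm_catCA (edges l1) [:: a.1] (edges l2)).
  rewrite ha => ka; move: up; rewrite pE edges_cat (perm_uniq pa) /=.
  by rewrite -edges_cat -ka map_f.
move: wp; rewrite pE cwalk_cat /= => /and3P[w1 /eqP ta w2].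
move: tp; rewrite pE target_cat => tp.
have c1 : ((target s l1).1 \in W) = (s.1 \in W).
  by apply: (walk_avoids_cut w1) => k kl; apply: na; rewrite mem_cat kl.
have c2 : ((target (dst a) l2).1 \in W) = (hend a \in W).
  by apply: (walk_avoids_cut w2) => k kl; apply: na; rewrite mem_cat kl orbT.
have aW : (hend a \in W) = (hend (other a) \in W).
  by rewrite -c2 -[target (dst a) l2]/(target (target s l1) (a :: l2)) tp /= -c1 -ta.
by move: hW oW; case: (same_edge ha) => ->; rewrite ?otherK -?aW => /negbTE->.
Qed.

(** The edge [e] is the only edge of [C] leaving the vertex set formed by [C1]
    and the part of the connecting path before [e]. *)
Lemma connecting_path_off_circuits C C1 P C2 u v e s b p :
  bicircuit_parts C C1 P C2 u v -> e \in P.2 ->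
  circuit_walk s b p -> {subset edges p <= C.2} -> e \notin edges p.
Proof.
case/orP=> [|/and5P[_ _ _ _ /andP[_ /andP[/eqP-> _]]]]; last by rewrite inE.
case/and5P=> /andP[/and3P[/forallP sg1 _ _] _] /andP[/and3P[/forallP sg2 _ _] _] dis.
case/existsP=> -[q /= _] /and5P[wq /eqP lq uq /eqP P1 /eqP P2].
case/and3P=> /eqP PC1 /eqP PC2 /eqP CE + rp pC.
rewrite P2 inE => /mapP[h hq ->]; apply/negP=> hp.
have {hq}[q1 [q2 qE]] : exists q1 q2, q = q1 ++ h :: q2.
  by case: (path.splitPr hq) => q1 q2; exists q1, q2.
move: wq; rewrite qE walk_cat /= => /and3P[w1 /eqP hh w2].
have vE : u :: [seq hend h | h <- q] = (u :: verts q1) ++ hend h :: verts q2.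
  by rewrite qE map_cat.
have {}uq : uniq (u :: [seq hend h | h <- q]) by exact: uq.
have {}lq : last u (u :: [seq hend h | h <- q]) = v by exact: lq.
rewrite /walk_vertices vE in P1 uq lq.
have P1E x : (x \in P.1) = (x \in u :: verts q1) || (x \in hend h :: verts q2).
  by rewrite P1 in_set mem_cat.
have sep x : x \in u :: verts q1 -> x \in hend h :: verts q2 -> False.
  move: uq;  rewrite cat_uniq => /and3P[_ /hasPn n _] x1 x2.
  by have := n x x2; rewrite /= x1.
pose W := C1.1 :|: [set x in u :: verts q1].
have WE x : (x \in W) = (x \in C1.1) || (x \in u :: verts q1) by rewrite !inE.
have notW x : x \in hend h :: verts q2 -> x \notin W.
  move=> x2; rewrite WE negb_or; apply/andP; split; last by apply/negP=> x1; apply: (sep x).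
  apply/negP=> xC; have : x \in P.1 :&: C1.1 by rewrite inE P1E x2 orbT.
  by rewrite PC1 inE => /eqP xu; apply: (sep x) => //; rewrite xu mem_head.
have [||k [kp kh kW okW]] := circuit_crosses_twice (W := W) rp hp.
- by apply: notW; rewrite mem_head.
- by rewrite WE hh mem_last orbT.
move: okW; rewrite WE negb_or => /andP[okC okq].
move: (pC _ kp); rewrite CE /sub_union /= !in_setU P2 => /orP[/orP[kC|kP]|kC].
- by have := sg1 (other k); rewrite kC (negbTE okC).
- have [j jq jk] : exists2 j, j \in q & k.1 = j.1.
    by move: kP; rewrite inE => /mapP[j jq jk]; exists j.
  move: jq; rewrite qE mem_cat in_cons => /or3P[j1|/eqP jh|j2].
  + have /andP[e1 e2] := walk_ends w1 j1.
    by case: (same_edge jk) okq => ->; rewrite ?otherK ?e1 ?e2.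
  + by rewrite jk jh eqxx in kh.
  have /andP[/notW e1 /notW e2] := walk_ends w2 j2.
  by case: (same_edge jk) kW => ->; rewrite ?(negbTE e1) ?(negbTE e2).
have := sg2 k; rewrite kC /= => kC2; move: kW; rewrite WE => /orP[kC1|k1].
  by have /pred0P/(_ (hend k)) := dis; rewrite /= kC1 kC2.
have : hend k \in P.1 :&: C2.1 by rewrite inE P1E k1.
rewrite PC2 inE => /eqP kv; apply: (sep (hend k)) => //.
by rewrite kv -lq last_cat /= mem_last.
Qed.

(** * Bicircuits assembled from walks *)

(** The hypotheses on vertices cover both types of bicircuit: for an empty
    connecting path [R] the states [t] and [flip s] coincide. *)
Section Bicircuit.
Variables (s : vertex G * bool) (L R M : seq (half_edge G)).
Let t := target (flip s) R.
Hypotheses (rL : circuit_walk s true L) (wR : cwalk (flip s) R).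
Hypothesis rM : circuit_walk t true M.
Hypothesis uR : uniq (s.1 :: verts R).
Hypothesis LR : forall x, x \in verts L -> x \in s.1 :: verts R -> x = s.1.
Hypothesis MR : forall x, x \in verts M -> x \in s.1 :: verts R -> x = t.1.
Hypothesis LM : forall x, x \in verts L -> x \in verts M -> R = [::] /\ x = s.1.

Local Notation cL := (span s L).
Local Notation cR := (span (flip s) R).
Local Notation cM := (span t M).

Definition bicircuit : subgraph G := sub_union (sub_union cL cR) cM.

Let bicircuit_edge e :
  (e \in bicircuit.2) = [|| e \in edges L, e \in edges R | e \in edges M].
Proof. by rewrite /bicircuit /sub_union /= !inE orbA. Qed.

Let mem_t : t.1 \in s.1 :: verts R.
Proof. by rewrite /t target_vertex mem_last. Qed.

(* An edge shared by R and one of the circuits would have both ends at the      *)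
(* unique common vertex, but a path contains no loop.                           *)
Let R_distinct_ends h : h.1 \in edges R -> hend (other h) != hend h.
Proof.
rewrite mem_edges mem_mirror => /orP[|] hR; first exact: path_no_loop wR uR hR.
by have := path_no_loop wR uR hR; rewrite otherK eq_sym.
Qed.

Let LR_edges e : e \in edges L -> e \notin edges R.
Proof.
move=> eL; apply/negP=> eR; have := R_distinct_ends (h := (e, true)) eR.
have end_s b : hend (e, b) = s.1.
  by apply: LR; [apply: (mem_verts_circuit rL) | apply: (mem_verts wR)].
by rewrite !end_s eqxx.
Qed.

Let MR_edges e : e \in edges M -> e \notin edges R.
Proof.
move=> eM; apply/negP=> eR; have := R_distinct_ends (h := (e, true)) eR.
have end_t b : hend (e, b) = t.1.
  by apply: MR; [apply: (mem_verts_circuit rM) | apply: (mem_verts wR)].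
by rewrite !end_t eqxx.
Qed.

Let tight_t : R = [::] -> t = flip s.
Proof. by rewrite /t => ->. Qed.

(* A common edge of L and M would be a loop at their common base, whose         *)
(* half-edges have opposite directions according to L and to M.                 *)
Let LM_edges e : e \in edges L -> e \notin edges M.
Proof.
move=> eL; apply/negP=> eM.
have [R0 hs] : R = [::] /\ hend (e, true) = s.1.
  by apply: LM; [apply: (mem_verts_circuit rL) | apply: (mem_verts_circuit rM)].
have := circuit_base (h := (e, true)) rL eL hs.
have := circuit_base (h := (e, true)) rM eM.
by rewrite (tight_t R0) => /(_ hs) -> /=; case: s.2.
Qed.

Lemma bicircuit_partsP : bicircuit_parts bicircuit cL cR cM s.1 t.1.
Proof.
have [R0|Rn] := eqVneq R [::]; rewrite /bicircuit_parts; apply/orP; [right|left].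
  rewrite /tight_bicircuit (circuit_unbalanced rL) (circuit_unbalanced rM) /=.
  have cRE : cR = ([set s.1], set0).
    by rewrite R0; congr (_, _); apply/setP=> x; rewrite !inE.
  have -> : cL.1 :&: cM.1 = [set s.1].
    apply/setP=> x; rewrite in_setI (circuit_vertex _ rL) (circuit_vertex _ rM) inE.
    apply/andP/eqP=> [[xL xM]|->]; first by case: (LM xL xM).
    split; first exact: circuit_start rL.
    by have := circuit_start rM; rewrite (tight_t R0).
  have -> : [disjoint cL.2 & cM.2].
    rewrite disjoints_subset; apply/subsetP=> e.
    by rewrite in_setC !span_edge; apply: LM_edges.
  have -> : t.1 == s.1 by rewrite (tight_t R0).
  rewrite cRE !eqxx /=.
  rewrite /bicircuit cRE; apply/eqP; congr (_, _); apply/setP=> x; rewrite !inE ?orbF //.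
  by case: (x == s.1); rewrite ?orbF ?orbT.
rewrite /long_bicircuit (circuit_unbalanced rL) (circuit_unbalanced rM) eqxx andbT /=.
apply/and4P; split.
- rewrite disjoints_subset; apply/subsetP=> x.
  rewrite in_setC (circuit_vertex _ rL) (circuit_vertex _ rM).
  by move=> xL; apply: contraNN Rn => xM; case: (LM xL xM) => ->.
- have sz : size R == #|cR.2|.
    rewrite cardsE (card_uniqP (path_edges_uniq wR uR)) size_map //.
  apply/existsP; exists (Tuple sz).
  have -> : last s.1 (walk_vertices s.1 (Tuple sz)) = t.1 by rewrite /t target_vertex.
  by rewrite (cwalk_walk wR) !eqxx !andbT; apply: uR.
- apply/eqP/setP=> x; rewrite in_setI (circuit_vertex _ rL) span_vertex inE.
  apply/andP/eqP=> [[xR xL]|->]; first exact: LR.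
  by split; [exact: mem_head | exact: circuit_start rL].
apply/eqP/setP=> x; rewrite in_setI (circuit_vertex _ rM) span_vertex inE.
apply/andP/eqP=> [[xR xM]|->]; first exact: MR.
by split; [exact: mem_t | exact: circuit_start rM].
Qed.

Lemma bicircuit_unbalanced : unbalanced_bicircuit bicircuit.
Proof.
apply/existsP; exists cL; apply/existsP; exists cR; apply/existsP; exists cM.
by apply/existsP; exists s.1; apply/existsP; exists t.1; apply: bicircuit_partsP.
Qed.

(** The base [s.1] has degree at least 3: two half-edges of [L], and one of [R]
    or [M]. *)
Lemma bicircuit_not_circuit : ~~ is_circuit bicircuit.
Proof.
apply/negP=> /and3P[_ _ /forall_inP deg].
have sC : s.1 \in bicircuit.1 by rewrite !inE eqxx.
have [k [kRM ks]] : exists k, (k.1 \in edges R) || (k.1 \in edges M) /\ hend k = s.1.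
  have := wR; case R0: R => [|h R'] /=.
    have /and4P[+ + _ _] := rM; rewrite (tight_t R0).
    case ME: M => [|h M'] //= _ /andP[/eqP [hh _] _].
    by exists (other h); rewrite hh /= mem_head.
  by case/andP=> /eqP[hh _] _; exists (other h); rewrite hh /= mem_head.
have kL : k.1 \notin edges L.
  apply/negP=> kL; case/orP: kRM => kE; first by move: kE; apply/negP/LR_edges.
  by move: kE; apply/negP/LM_edges.
have sL : s.1 \in (span s L).1 by rewrite span_vertex mem_head.
have := deg _ sC; have := circuit_degree rL sL; rewrite /degree => d2 d3.
have inC (C : subgraph G) x h :
  (h \in [set h : half_edge G | (h.1 \in C.2) && (hend h == x)])
    = (h.1 \in C.2) && (hend h == x) by rewrite in_set.
have : k |: [set h : half_edge G | (h.1 \in cL.2) && (hend h == s.1)]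
    \subset [set h : half_edge G | (h.1 \in bicircuit.2) && (hend h == s.1)].
  apply/subsetP=> h; rewrite in_setU1 => /predU1P[->|].
    by rewrite inC bicircuit_edge kRM ks eqxx orbT.
  by rewrite !inC bicircuit_edge span_edge => /andP[-> ->].
move/subset_leq_card; rewrite (eqP d3) cardsU1 inC span_edge (negbTE kL) /=.
by rewrite d2.
Qed.

Lemma bicircuit_consistent : consistently_directed o bicircuit.
Proof.
rewrite /consistently_directed /balanced_circuit (negbTE bicircuit_not_circuit) /=.
apply/existsP; exists cL; apply/existsP; exists cR; apply/existsP; exists cM.
apply/existsP; exists s.1; apply/existsP; exists t.1; rewrite bicircuit_partsP /=.
apply/forallP=> h; apply/forallP=> k; apply/implyP=> /and4P[hC kC hk /eqP e].
rewrite /exceptional_pair !span_edge /consistent_pair.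
have VR j : j.1 \in edges R -> hend j \in s.1 :: verts R by exact: (mem_verts wR).
have VL j : j.1 \in edges L -> hend j \in verts L by apply: mem_verts_circuit rL.
have VM j : j.1 \in edges M -> hend j \in verts M by apply: mem_verts_circuit rM.
have noLR (j : half_edge G) : j.1 \in edges R -> (j.1 \in edges L) = false.
  by move=> jR; apply/negbTE/negP=> /LR_edges; rewrite jR.
have noMR (j : half_edge G) : j.1 \in edges R -> (j.1 \in edges M) = false.
  by move=> jR; apply/negbTE/negP=> /MR_edges; rewrite jR.
have noML (j : half_edge G) : j.1 \in edges L -> (j.1 \in edges M) = false.
  by move=> /LM_edges/negbTE.
have noLM (j : half_edge G) : j.1 \in edges M -> (j.1 \in edges L) = false.
  by move=> jM; apply/negbTE/negP=> /LM_edges; rewrite jM.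
have oLR i j : i.1 \in edges L -> j.1 \in edges R -> hend i = hend j -> o i != o j.
  move=> iL jR ij; have is' : hend i = s.1 by apply: LR; rewrite ?VL // ij VR.
  rewrite (circuit_base rL iL is').
  have [_ ->] := path_start wR uR jR (etrans (esym ij) is').
  by rewrite /= negbK; case: s.2.
have oMR i j : i.1 \in edges M -> j.1 \in edges R -> hend i = hend j -> o i != o j.
  move=> iM jR ij; have it : hend i = t.1 by apply: MR; rewrite ?VM // ij VR.
  rewrite (circuit_base rM iM it).
  have [_ ->] := path_end wR uR jR (etrans (esym ij) it).
  by rewrite -/t; case: t.2.
have oLM i j : i.1 \in edges L -> j.1 \in edges M -> hend i = hend j -> o i != o j.
  move=> iL jM ij.
  have [R0 is'] : R = [::] /\ hend i = s.1 by apply: LM; rewrite ?VL // ij VM.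
  rewrite (circuit_base rL iL is') (circuit_base rM jM) (tight_t R0) /= -?ij //.
  by case: s.2.
move: hC kC; rewrite !bicircuit_edge => /or3P[hL|hR|hM] /or3P[kL|kR|kM].
- rewrite hL kL (noML _ hL) /= orbF; have [hs|hs] := eqVneq (hend h) s.1.
    by rewrite (circuit_base rL hL hs) (circuit_base rL kL) ?eqxx // -e.
  by rewrite (circuit_pass rL hL kL hk e hs).
- by rewrite (noLR _ kR) (noMR _ kR) !andbF (oLR h k hL kR e).
- by rewrite (noML _ hL) (noLM _ kM) !andbF (oLM h k hL kM e).
- by rewrite (noLR _ hR) (noMR _ hR) [o h == o k]eq_sym (oLR k h kL hR (esym e)).
- by rewrite (noLR _ hR) (noMR _ hR); case: (path_pass wR uR hR kR hk e) => _ _ ->.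
- by rewrite (noLR _ hR) (noMR _ hR) [o h == o k]eq_sym (oMR k h kM hR (esym e)).
- by rewrite (noLM _ hM) (noML _ kL) !andbF [o h == o k]eq_sym (oLM k h kL hM (esym e)).
- by rewrite (noLR _ kR) (noMR _ kR) !andbF (oMR h k hM kR e).
rewrite hM kM (noLM _ hM) /=; have [ht|ht] := eqVneq (hend h) t.1.
  by rewrite (circuit_base rM hM ht) (circuit_base rM kM) ?eqxx // -e.
by rewrite (circuit_pass rM hM kM hk e ht).
Qed.

(** The values of [chi] quantify over all choices of parts, while the right-hand
    side refers to one; the bridge property identifies the connecting paths. *)
Lemma chi_bicircuit e :
  (chi bicircuit e = 1 / 2 * weight L e + weight R e + 1 / 2 * weight M e)%R.
Proof.
rewrite /chi /balanced_circuit (negbTE bicircuit_not_circuit) /=.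
rewrite !weight_uniq ?(circuit_edges_uniq rL) ?(circuit_edges_uniq rM)
  ?(path_edges_uniq wR uR) //.
have subL : {subset edges L <= bicircuit.2} by move=> f fL; rewrite bicircuit_edge fL.
have subM : {subset edges M <= bicircuit.2} by move=> f fM; rewrite bicircuit_edge fM !orbT.
have sub_parts C1 P C2 u v : bicircuit_parts bicircuit C1 P C2 u v ->
    bicircuit = sub_union (sub_union C1 P) C2.
  case/orP=> [/and5P[_ _ _ _ /and3P[_ _ /eqP//]]|].
  case/and5P=> _ _ /eqP uC _ /and3P[_ /eqP-> /eqP->].
  have : u \in C1.1 :&: C2.1 by rewrite uC inE.
  rewrite inE => /andP[uC1 _]; congr (_, _) => /=; last by rewrite setU0.
  by congr (_ :|: _); apply/setP=> x; rewrite !inE; case: eqP => [->|]; rewrite ?uC1 ?orbF.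
have -> : on_connecting_path bicircuit e = (e \in edges R).
  apply/existsP/idP=> [|eR].
    case=> C1 /existsP[P /existsP[C2 /existsP[u /existsP[v /andP[pC eP]]]]].
    have : e \in bicircuit.2 by rewrite (sub_parts _ _ _ _ _ pC) !inE eP orbT.
    rewrite bicircuit_edge.
    rewrite (negbTE (connecting_path_off_circuits pC eP rL subL)).
    by rewrite (negbTE (connecting_path_off_circuits pC eP rM subM)) orbF.
  exists cL; apply/existsP; exists cR; apply/existsP; exists cM; apply/existsP; exists s.1.
  by apply/existsP; exists t.1; rewrite bicircuit_partsP span_edge.
have [eR|nR] := boolP (e \in edges R).
  have /negbTE-> : e \notin edges L by apply: contraL eR; apply: LR_edges.
  have /negbTE-> : e \notin edges M by apply: contraL eR; apply: MR_edges.
  by rewrite !mulr0 add0r addr0.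
have -> : on_bicircuit_circuit bicircuit e = (e \in edges L) || (e \in edges M).
  apply/existsP/idP=> [|eLM].
    case=> C1 /existsP[P /existsP[C2 /existsP[u /existsP[v /andP[pC eC]]]]].
    have : e \in bicircuit.2.
      by rewrite (sub_parts _ _ _ _ _ pC) /sub_union /= setUAC in_setU eC.
    by rewrite bicircuit_edge (negbTE nR).
  exists cL; apply/existsP; exists cR; apply/existsP; exists cM.
  apply/existsP; exists s.1; apply/existsP; exists t.1.
  by rewrite bicircuit_partsP in_setU !span_edge.
have [eL|_] := boolP (e \in edges L);
  first by rewrite (negbTE (LM_edges eL)) mulr1 mulr0 !addr0.
by case: (e \in edges M); rewrite ?mulr1 !mulr0 ?addr0 ?add0r.
Qed.
End Bicircuit.

Local Open Scope ring_scope.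

(** * Decomposing closed walks *)

Definition consistent_circuit (C : subgraph G) : bool :=
  signed_circuit C && consistently_directed o C.

Definition decomposes (w : edge G -> rat) : Prop :=
  exists2 Cs, all consistent_circuit Cs & forall e, w e = \sum_(C <- Cs) chi C e.

Lemma decomposesD w1 w2 w : decomposes w1 -> decomposes w2 ->
  (forall e, w e = w1 e + w2 e) -> decomposes w.
Proof.
move=> [C1 g1 E1] [C2 g2 E2] E; exists (C1 ++ C2); first by rewrite all_cat g1.
by move=> e; rewrite big_cat -E1 -E2.
Qed.

Lemma decomposes_balanced s p : circuit_walk s false p -> decomposes (weight p).
Proof.
move=> rp; exists [:: span s p]; last by move=> e; rewrite big_seq1 chi_balanced.
by rewrite /= /consistent_circuit /signed_circuit circuit_balanced // circuit_consistent.
Qed.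

Lemma weight_cat p q e : weight (p ++ q) e = weight p e + weight q e.
Proof. by rewrite /weight /multiplicity edges_cat count_cat natrD. Qed.

(** [A] plays the role of the support of the flow. *)
Section NoBalancedCircuit.
Variable A : pred (edge G).
Hypothesis noA : forall s p, all A (edges p) -> ~~ circuit_walk s false p.

(** Cut [L] at the first vertex where [Q] meets it, into [L1] before and [L2]
    after. There [Q] arrives either in the same state as [L], and [L2] leads on
    to [flip s], or in the flipped state, and the mirror image of [L1] does.
    Either way a balanced circuit is closed. *)
Lemma unbalanced_circuit_avoided s L Q x :
  circuit_walk s true L -> all A (edges L) -> cwalk (flip s) Q -> all A (edges Q) ->
  uniq (s.1 :: verts Q) -> x \in verts Q -> x \notin verts L.
Proof.
move=> rL AL wQ AQ uQ xQ; apply/negP=> xL.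
have /and4P[_ wL /eqP tL uL] := rL.
have hQ : has (fun h => hend h \in verts L) Q.
  by case/mapP: xQ => h hQ xE; apply/hasP; exists h; rewrite // -xE.
case: (split_find hQ) wQ AQ uQ => q Q0 Q2 qL noQ0; rewrite -/(verts _).
rewrite cwalk_cat edges_cat all_cat verts_cat -cat_cons cat_uniq.
move=> /andP[wQ _] /andP[AQ _] /andP[uQ _] {hQ Q2 xQ xL}.
have tQ : target (flip s) (rcons Q0 q) = dst q by rewrite target_rcons.
have [sQ uQ'] : s.1 \notin verts (rcons Q0 q) /\ uniq (verts (rcons Q0 q)) by apply/andP.
have qs : hend q != s.1.
  by apply: contraNneq sQ => <-; rewrite verts_rcons mem_rcons mem_head.
have [L1 [L2 [LE t1]]] : exists L1 L2, L = L1 ++ L2 /\ last s.1 (verts L1) = hend q.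
  by apply: split_at_value; rewrite in_cons qL orbT.
move: wL AL tL uL noQ0; rewrite LE cwalk_cat edges_cat all_cat target_cat.
rewrite verts_cat cat_uniq.
move=> /andP[w1 w2] /andP[A1 A2] t2 /and3P[u1 /hasPn d12 u2] /hasPn noQ0.
have q1 : hend q \in verts L1.
  by have := mem_last s.1 (verts L1); rewrite t1 in_cons (negbTE qs).
(* R is the part of L, or of its mirror image, that leads from Q back to flip s. *)
have join R : cwalk (dst q) R -> target (dst q) R = flip s -> all A (edges R) ->
    uniq (hend q :: verts R) -> {subset verts R <= verts L1 ++ verts L2} -> False.
  move=> wR tR AR; rewrite cons_uniq => /andP[qR uR] sR.
  have /negP[] : ~~ circuit_walk (flip s) false (rcons Q0 q ++ R).
    by apply: noA; rewrite edges_cat all_cat AQ.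
  apply/and4P; split; first by case: (Q0).
  - by rewrite cwalk_cat wQ tQ.
  - by rewrite target_cat tQ tR addbF -surjective_pairing.
  rewrite verts_cat cat_uniq uQ' uR andbT.
  apply/hasPn=> y yR; rewrite verts_rcons mem_rcons in_cons negb_or.
  apply/andP; split; first by apply: contraNneq qR => <-.
  by apply/negP=> /mapP[h /noQ0 + yE]; rewrite /= -yE sR.
have t1E : target s L1 = (hend q, (target s L1).2).
  by rewrite [LHS]surjective_pairing target_vertex t1.
have [ot|ot] := eqVneq (target s L1).2 (o q).
  have hq : target s L1 = dst q by rewrite t1E ot.
  apply: (join L2); rewrite -?hq //.
    by rewrite t2 /flip addbT.
    rewrite /= u2 andbT; apply/negP=> /d12 /=.
    by rewrite q1.
  by move=> y y2; rewrite mem_cat y2 orbT.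
have hq : flip (target s L1) = dst q.
  by rewrite t1E /flip /dst /=; congr (_, _); move: ot; case: (o q); case: (_.2).
have [wm tm] := cwalk_mirror w1; rewrite hq in wm tm.
have s2 : s.1 \in verts L2.
  have := mem_last (target s L1).1 (verts L2); rewrite -target_vertex t2 /=.
  by rewrite in_cons t1E /= eq_sym (negbTE qs).
have us1 : uniq (s.1 :: verts L1) by rewrite /= u1 andbT; apply: d12.
have rE := verts_mirror_path w1; rewrite target_vertex t1 in rE.
apply: (join (mirror L1)) => //.
- by rewrite edges_mirror all_rev.
- by rewrite -rE rev_uniq.
move=> y ym; have : y \in rev (s.1 :: verts L1) by rewrite rE in_cons ym orbT.
by rewrite mem_rev in_cons mem_cat => /predU1P[->|->//]; rewrite s2 orbT.
Qed.

(** The avoidance property is used three times: [R] avoids [L]; the mirror image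
    of [R] avoids [M]; and once [R] followed by [M] is known to repeat no vertex
    before its end, it avoids [L] as well. *)
Lemma decomposes_bicircuit s L R M (t := target (flip s) R) :
  circuit_walk s true L -> cwalk (flip s) R -> circuit_walk t true M ->
  all A (edges L) -> all A (edges R) -> all A (edges M) -> uniq (s.1 :: verts R) ->
  decomposes (fun e => 1 / 2 * weight L e + weight R e + 1 / 2 * weight M e).
Proof.
move=> rL wR rM AL AR AM uR.
have LR x : x \in verts L -> x \in s.1 :: verts R -> x = s.1.
  move=> xL; rewrite in_cons => /predU1P[//|xR].
  by have := unbalanced_circuit_avoided rL AL wR AR uR xR; rewrite xL.
have MR x : x \in verts M -> x \in s.1 :: verts R -> x = t.1.
  have [wm _] := cwalk_mirror wR.
  move=> xM; rewrite -mem_rev (verts_mirror_path wR) in_cons => /predU1P[//|xR].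
  have Am : all A (edges (mirror R)) by rewrite edges_mirror all_rev.
  have := unbalanced_circuit_avoided rM AM wm Am (path_uniq_mirror wR uR) xR.
  by rewrite xM.
have LM x : x \in verts L -> x \in verts M -> R = [::] /\ x = s.1.
  move=> xL xM; have [M0 [m [ME wM0 _ [hm _]]]] := circuit_rcons rM.
  rewrite cons_uniq => /andP[tM0 uM0].
  have AM0 : all A (edges M0) by move: AM; rewrite ME -cats1 edges_cat all_cat => /andP[].
  have sM0 : {subset verts M0 <= verts M}.
    by move=> y yM; rewrite ME verts_rcons mem_rcons in_cons yM orbT.
  have wRM : cwalk (flip s) (R ++ M0) by rewrite cwalk_cat wR.
  have ARM : all A (edges (R ++ M0)) by rewrite edges_cat all_cat AR.
  have uRM : uniq (s.1 :: verts (R ++ M0)).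
    rewrite verts_cat -cat_cons cat_uniq uR uM0 andbT /=.
    apply/hasPn=> y yM0; apply: contra tM0 => yR.
    by rewrite -(MR y) ?sM0.
  have := unbalanced_circuit_avoided rL AL wRM ARM uRM (x := x).
  rewrite xL verts_cat mem_cat.
  move: xM; rewrite ME verts_rcons mem_rcons in_cons => /predU1P[xt|->]; last first.
    by rewrite orbT => /(_ isT).
  rewrite {}hm in xt; have := mem_last s.1 (verts R).
  rewrite -(target_vertex (flip s)) -/t -xt in_cons => /predU1P[xs _|-> /(_ isT)//].
  split=> //; case RE: R => [//|r R'].
  move: uR; rewrite RE cons_uniq => /andP[/negP[]].
  by rewrite -xs xt /t target_vertex RE; exact: (mem_last (hend r) (verts R')).
exists [:: bicircuit s L R M]; last by move=> e; rewrite big_seq1 chi_bicircuit.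
rewrite /= andbT /consistent_circuit /signed_circuit bicircuit_unbalanced // orbT.
exact: bicircuit_consistent.
Qed.

(** The segment closed by the first repeated vertex is a circuit; it is
    unbalanced because balanced ones are excluded. *)
Lemma first_unbalanced_circuit s R :
  cwalk s R -> all A (edges R) -> ~~ uniq (s.1 :: verts R) ->
  exists P L Q, [/\ R = P ++ L ++ Q, uniq (s.1 :: verts P)
                  & circuit_walk (target s P) true L].
Proof.
move=> wR AR /first_repeat[R1 [r [Q [RE uR1 rR1]]]].
have [P [K [R1E tP]]] := split_at_value rR1.
have {}RE : R = P ++ rcons K r ++ Q by rewrite RE R1E -catA cat_rcons.
exists P, (rcons K r), Q; move: uR1; rewrite -/(verts R1) R1E verts_cat.
rewrite -cat_cons cat_uniq => /and3P[uP /hasPn dPK uK]; split=> //.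
have rv : hend r = (target s P).1 by rewrite target_vertex.
have tr : target (target s P) (rcons K r) = ((target s P).1, o r).
  by rewrite target_rcons /dst rv.
have cwb : circuit_walk (target s P) ((target s P).2 != o r) (rcons K r).
  apply/and4P; split; first by case: (K).
  - by move: wR; rewrite RE !cwalk_cat => /and3P[].
  - by rewrite tr; apply/eqP; congr (_, _); case: (o r); case: (_.2).
  rewrite verts_rcons rcons_uniq uK andbT.
  by apply/negP=> /dPK /=; rewrite rv target_vertex mem_last.
have AL : all A (edges (rcons K r)).
  by move: AR; rewrite RE !edges_cat !all_cat => /and3P[].
by case: eqP cwb => // _ cwf; case/negP: (noA (target s P) AL).
Qed.

(** The walk [R] may repeat vertices and may meet [L] and [M]; each circuit that
    it closes on the way is shared between two consecutive bicircuits. *)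
Lemma decomposes_walk s L R M (t := target (flip s) R) :
  circuit_walk s true L -> cwalk (flip s) R -> circuit_walk t true M ->
  all A (edges L) -> all A (edges R) -> all A (edges M) ->
  decomposes (fun e => 1 / 2 * weight L e + weight R e + 1 / 2 * weight M e).
Proof.
rewrite {}/t; have [n] := ubnP (size R); elim: n s L R => // n IHn s L R.
rewrite ltnS => szR rL wR rM AL AR AM.
have [uR|nuR] := boolP (uniq (s.1 :: verts R));
  first exact: (decomposes_bicircuit rL wR rM).
have [P [L' [Q [RE uP rL']]]] := first_unbalanced_circuit wR AR nuR.
have /and4P[L'0 _ /eqP tL' _] := rL'; rewrite addbT -/(flip _) in tL'.
move: wR AR rM szR; rewrite RE !cwalk_cat !edges_cat !all_cat !target_cat tL'.
move=> /and3P[wP _ wQ] /and3P[AP AL' AQ] rM szR.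
have szQ : (size Q < n)%N.
  apply: leq_trans szR; case: (L') L'0 => //= h K _.
  by rewrite !size_cat /= size_cat addnS ltnS addnA leq_addl.
have D1 := decomposes_bicircuit rL wP rL' AL AP AL' uP.
have D2 := IHn _ _ _ szQ rL' wQ rM AL' AQ AM.
by apply: (decomposesD D1 D2) => e; rewrite !weight_cat; lra.
Qed.

Lemma decomposes_closed_walk s p : cwalk s p -> target s p = s -> p != [::] ->
  all A (edges p) -> decomposes (weight p).
Proof.
move=> wp tp p0 Ap.
have nu : ~~ uniq (s.1 :: verts p).
  rewrite cons_uniq negb_and negbK -{1}tp target_vertex.
  by case: p p0 {wp tp Ap} => //= h p _; rewrite mem_last.
have [P [L [Q [pE _ rL]]]] := first_unbalanced_circuit wp Ap nu.
have /and4P[_ _ /eqP tL _] := rL; rewrite addbT -/(flip _) in tL.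
move: wp Ap tp; rewrite pE !cwalk_cat !edges_cat !all_cat !target_cat tL.
move=> /and3P[wP _ wQ] /and3P[AP AL AQ] tQ.
have wQP : cwalk (flip (target s P)) (Q ++ P) by rewrite cwalk_cat wQ tQ.
(* The rotated walk leaves L and returns to L, which plays both end circuits.   *)
have rL' : circuit_walk (target (flip (target s P)) (Q ++ P)) true L.
  by rewrite target_cat tQ.
have AQP : all A (edges (Q ++ P)) by rewrite edges_cat all_cat AQ.
have [Cs gCs E] := decomposes_walk rL wQP rL' AL AQP AL.
by exists Cs => // e; rewrite -E !weight_cat; lra.
Qed.
End NoBalancedCircuit.

(** * Closed walks inside a flow *)

Definition sgn (b : bool) : int := if b then 1 else -1.
Definition net (g : edge G -> int) x : int :=
  \sum_(h : half_edge G | hend h == x) sgn (o h) * g h.1.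
Definition charge s x : int := if s.1 == x then sgn s.2 else 0.

Lemma flow_net (g : edge G -> int) : is_flow o g <-> forall x, net g x = 0.
Proof.
have netE x : net g x = \sum_(h : half_edge G | (hend h == x) && o h) g h.1
    - \sum_(h : half_edge G | (hend h == x) && ~~ o h) g h.1.
  rewrite /net (bigID o) /= -sumrN; congr (_ + _); apply: eq_bigr => h /andP[_ oh].
    by rewrite oh mul1r.
  by rewrite (negbTE oh) mulN1r.
by split=> gP x; have := gP x; rewrite netE; [move=> ->; rewrite subrr | move/subr0_eq].
Qed.

Lemma netB (g1 g2 g : edge G -> int) x : (forall e, g e = g1 e - g2 e) ->
  net g x = net g1 x - net g2 x.
Proof.
by move=> E; rewrite /net -sumrB; apply: eq_bigr => h _; rewrite E mulrBr.
Qed.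

(** Along a consistent walk, the arrival at each intermediate state cancels the
    departure from it. *)
Lemma net_walk s p x : cwalk s p ->
  net (fun e => (multiplicity p e)%:Z) x = charge (target s p) x - charge s x.
Proof.
elim: p s => [|h p IHp] s /=.
  by rewrite subrr /net big1 // => h _; rewrite mulr0.
case/andP=> /eqP <- /IHp netp.
have -> : target (src h) (h :: p) = target (dst h) p by [].
rewrite (netB (g1 := fun e => (multiplicity p e)%:Z)
  (g2 := fun e => - (h.1 == e)%:Z)); last first.
  by move=> e; rewrite /multiplicity /= PoszD opprK addrC.
rewrite netp -addrA; congr (_ + _).
suff -> : net (fun e => - (h.1 == e)%:Z) x = charge (src h) x - charge (dst h) x.
  by rewrite !opprB; ring.
rewrite /net big_mkcond (bigD1 h) //= (bigD1 (other h)) ?other_neq //= big1 ?addr0.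
  rewrite eqxx /charge /src /dst /=.
  by do 2 case: (_ == x); case: (o h); case: (o (other h)).
move=> k /andP[kh ko]; case: ifP => // _.
case: eqP => [/same_edge[e|e]|_]; last by rewrite oppr0 mulr0.
  by rewrite e eqxx in kh.
by rewrite e otherK eqxx in ko.
Qed.

(** Removing the walk from the flow leaves an imbalance at its end, of the sign
    that only an unused half-edge suitable for leaving this end can produce. *)
Lemma extend_walk (f : edge G -> nat) s p : is_flow o (fun e => (f e)%:Z) ->
  cwalk s p -> (forall e, multiplicity p e <= f e)%N -> target s p != s ->
  exists k, src k = target s p /\ (multiplicity p k.1 < f k.1)%N.
Proof.
move=> /flow_net fP wp pf ts; set t := target s p in ts *.
have [/existsP[k /andP[/eqP kt kf]]|/existsPn noK] :=
  boolP [exists k, (src k == t) && (multiplicity p k.1 < f k.1)%N]; first by exists k.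
pose d e : int := (f e)%:Z - (multiplicity p e)%:Z.
have net_d : net d t.1 = charge s t.1 - charge t t.1.
  by rewrite (netB _ (fun e => erefl (d e))) fP (net_walk _ wp) sub0r opprB.
(* If no half-edge leaves the state t, those at t.1 that still carry flow all    *)
(* have the direction t.2, so they contribute with the sign of t.2.              *)
have : 0 <= sgn t.2 * net d t.1.
  rewrite /net mulr_sumr; apply: sumr_ge0 => h /eqP ht.
  have d0 : 0 <= d h.1 by rewrite subr_ge0 lez_nat.
  have [oh|oh] := eqVneq (o h) t.2;
    first by rewrite oh; case: (t.2); rewrite ?mul1r ?mulN1r ?opprK.
  suff -> : d h.1 = 0 by rewrite !mulr0.
  have := noK (other h); rewrite /src otherK /= negb_and -leqNgt => /orP[/negP[]|fle].
    by rewrite [t]surjective_pairing ht xpair_eqE eqxx /=; case: (o h) (t.2) oh => [] [].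
  by apply/eqP; rewrite subr_eq0 eqz_nat eqn_leq fle pf.
rewrite net_d /charge eqxx; case: eqP => [st|_]; last by case: (t.2).
suff -> : s.2 = ~~ t.2 by case: (t.2).
move: ts; rewrite [s]surjective_pairing [t]surjective_pairing st xpair_eqE eqxx /=.
by case: (s.2) (t.2) => [] [].
Qed.

Lemma sum_multiplicity p : (\sum_e multiplicity p e = size p)%N.
Proof.
elim: p => [|h p IHp]; first by rewrite big1.
rewrite /multiplicity /= big_split /= -/(multiplicity p) IHp (bigD1 h.1) //= eqxx big1 //.
by move=> e; rewrite eq_sym => /negbTE->.
Qed.

Lemma closed_walk_in_flow (f : edge G -> nat) : is_flow o (fun e => (f e)%:Z) ->
  (exists e, 0 < f e)%N ->
  exists s p, [/\ cwalk s p, target s p = s, p != [::]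
                & forall e, (multiplicity p e <= f e)%N].
Proof.
move=> fP [e0 fe0].
suff H n s p : (\sum_e f e <= n + size p)%N -> cwalk s p -> p != [::] ->
    (forall e, multiplicity p e <= f e)%N ->
    exists s p, [/\ cwalk s p, target s p = s, p != [::]
                & forall e, (multiplicity p e <= f e)%N].
  apply: (H (\sum_e f e)%N (src (e0, true)) [:: (e0, true)]) => //=.
  - exact: leq_addr.
  - by rewrite eqxx.
  by move=> e; rewrite /multiplicity /= addn0; case: eqP => // <-.
(* A walk of length larger than the total value of f cannot respect f, so the    *)
(* extension process stops, which it only does at a closed walk.                 *)
elim: n p => [|n IHn] p szp wp p0 pf;
  have [ts|ts] := eqVneq (target s p) s; try by exists s, p.
all: have [k [kt kf]] := extend_walk fP wp pf ts.
  move: szp; rewrite add0n leqNgt => /negP[]; rewrite -sum_multiplicity.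
  rewrite (bigD1 k.1) //= [ltnRHS](bigD1 k.1) //= -addSn leq_add // leq_sum //.
apply: (IHn (rcons p k)).
- by rewrite size_rcons addnS -addSn.
- by rewrite cwalk_rcons wp kt eqxx.
- by case: (p).
move=> e; rewrite /multiplicity /edges map_rcons -cats1 count_cat /= addn0.
by case: eqP => [<-|_]; rewrite ?addn1 ?addn0 //; apply: pf.
Qed.

Lemma decomposes_flow (f : edge G -> nat) :
  is_flow o (fun e => (f e)%:Z) -> decomposes (fun e => (f e)%:R).
Proof.
have [n] := ubnP (\sum_e f e)%N; elim: n f => // n IHn f; rewrite ltnS => fn fP.
have [/existsP f0|/existsPn f0] := boolP [exists e, 0 < f e]%N; last first.
  exists [::] => // e; rewrite big_nil; have := f0 e.
  by rewrite -eqn0Ngt => /eqP->.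
suff [s [p [wp tp p0 [pf Dp]]]] : exists s p, [/\ cwalk s p, target s p = s, p != [::] &
    (forall e, multiplicity p e <= f e)%N /\ decomposes (weight p)].
  pose f' e := (f e - multiplicity p e)%N.
  have f'E e : (f' e)%:Z = (f e)%:Z - (multiplicity p e)%:Z by rewrite subzn.
  have f'P : is_flow o (fun e => (f' e)%:Z).
    apply/flow_net => x; rewrite (netB _ f'E) (net_walk _ wp) tp subrr subr0.
    by have /flow_net := fP.
  have f'n : (\sum_e f' e < n)%N.
    apply: leq_trans fn; rewrite /f' sumnB // sum_multiplicity.
    have szp : (size p <= \sum_e f e)%N by rewrite -sum_multiplicity; apply: leq_sum.
    by rewrite ltn_subrL; case: (p) p0 szp => //= h q _ szp; rewrite (leq_trans _ szp).
  apply: (decomposesD Dp (IHn f' f'n f'P)) => e.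
  by rewrite /weight /f' -natrD subnKC.
pose A : pred (edge G) := fun e => (0 < f e)%N.
have [[s [p [Ap rp]]]|noA] :=
  classic (exists s p, all A (edges p) /\ circuit_walk s false p).
  exists s, p; have /and4P[p0 wp /eqP tp _] := rp; split=> //.
    by rewrite tp addbF -surjective_pairing.
  split; last exact: decomposes_balanced rp.
  move=> e; rewrite /multiplicity count_uniq_mem ?(circuit_edges_uniq rp) //.
  by case: (boolP (e \in edges p)) => // /(allP Ap).
have [s [p [wp tp p0 pf]]] := closed_walk_in_flow fP f0.
exists s, p; split=> //; split=> //.
apply: (decomposes_closed_walk (A := A)) wp tp p0 _.
  by move=> s' p' Ap'; apply/negP=> rp'; apply: noA; exists s', p'.
by apply/allP=> e ep; apply: leq_trans (pf e); rewrite -has_count has_pred1.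
Qed.
End ConsistentWalks.

(** * The decomposition theorem *)

Local Open Scope ring_scope.

Theorem theorem3p1 (G : signed_graph) (o : half_edge G -> bool)
    (phi : edge G -> int)
    (ho : is_orientation o) (hphi : is_flow o phi) :
  exists (o' : half_edge G -> bool) (S : {set subgraph G}) (n : subgraph G -> nat),
    [/\ positive_orientation o phi o',
        (forall C : subgraph G, C \in S ->
           [/\ signed_circuit C, consistently_directed o' C & (0 < n C)%N]) &
        forall e : edge G,
          (express o o' phi e)%:~R = \sum_(C in S) (n C)%:R * chi C e :> rat].
Proof.
(* Reversing the edges of negative value expresses phi as its absolute value.   *)
pose o' h := if 0 <= phi h.1 then o h else ~~ o h.
have ho' : is_orientation o'.
  move=> e; rewrite -ho /o' /=; case: ifP => // _.
  by case: (o (e, false)); case: (o (e, true)).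
have exprE e : express o o' phi e = `|phi e|%N%:Z.
  rewrite /express /o' /= abszE; case: (ger0P (phi e)) => phie.
    by case: forallP => // -[] b.
  by case: forallP => // /(_ true); case: (o _).
have hflow : is_flow o' (fun e => `|phi e|%N%:Z).
  apply/flow_net => x; have /flow_net/(_ x) <- := hphi.
  apply: eq_bigr => h _; rewrite /o' abszE; case: (ger0P (phi h.1)) => // _.
  by case: (o h); rewrite ?mulN1r ?mul1r ?opprK.
have [Cs gCs fE] := decomposes_flow ho' hflow.
exists o', [set C in Cs], (fun C => count_mem C Cs); split.
- by split=> // e; rewrite exprE.
- move=> C; rewrite inE => CCs; have /andP[sC cC] := allP gCs C CCs.
  by split; rewrite // -has_count has_pred1.
move=> e; rewrite exprE -pmulrn fE big_seq.
(* Equal circuits in the list are collected into one coefficient.               *)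
rewrite (partition_big id (mem [set C in Cs])) /=; last first.
  by move=> C; rewrite inE.
apply: eq_bigr => C; rewrite inE => CCs.
rewrite (eq_bigl (pred1 C)) => [|D];
  last by rewrite /=; case: eqP => [->|]; rewrite ?CCs ?andbF.
rewrite (eq_bigr (fun=> chi C e)) => [|D /eqP-> //].
by rewrite big_const_seq iter_addr_0 mulr_natl.
Qed.
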